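(* Let a source $s\in C$ lie in exactly one of the localization regions $W_1,\dots,W_N$, and let each sensor use the aggregate of $k$ noisy measurements. (i) (All-to-all communication MAP.) If the communication graph is complete and at least three of the sensors are non-collinear, then the decision $j^*$ of the all-to-all communication MAP algorithm converges almost surely, as $k\to\infty$, to the correct decision: the index of the region containing $s$. (ii) (Limited communication MAP.) If every sensor can communicate with its neighbors in the communication graph and at least three sensors are non-collinear in each neighborhood $\mathcal{N}_i$, then for every sensor $i$ the decision $j^*$ of the limited communication MAP algorithm converges almost surely, as $k\to\infty$, to the correct decision: the index $j\in\mathcal{N}_i$ with $s\in W_j$ if there is one, and $0$ (the hypothesis ''source outside the neighborhood'') otherwise.
   Context: $C\subset\mathbb{R}^2$ is a compact connected region of area $A$, divided into compact regions $W_1,\dots,W_N$ with union $C$, disjoint up to overlaps of zero area. Sensor $i$ is at $x_i\in W_i$. Let $P>0$, $d_0>0$, $\beta>2$, $\sigma>0$. Sensor $i$ takes measurements $\ln\frac{Pd_0}{d_0+\|x_i-s\|^\beta}+n_i(l)$, $l=1,2,\dots$, where all $n_i(l)$ are independent Gaussian with mean $0$ and variance $\sigma^2$; its aggregated measurement $\ln P_{r_i}$ after $k$ samples is the average of the first $k$, so its noise has variance $\sigma^2(k)=\sigma^2/k$. For a set $M$ of sensors and a region $W\subset C$ put $$\Theta_k(M,W)=\frac1A\int_W\prod_{l\in M}\frac{1}{(2\pi\sigma^2(k))^{1/2}}\exp\Big(-\frac{\big(\ln P_{r_l}-\ln\frac{Pd_0}{d_0+\|x_l-y\|^\beta}\big)^2}{2\sigma^2(k)}\Big)dy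 .$$ This is the joint density of the measurements of the sensors in $M$ given that the source is in $W$, times the prior probability of $W$ under the uniform prior on $C$. All-to-all communication MAP: every sensor computes $\theta_j=\Theta_k(\{1,\dots,N\},W_j)$ for all $j\in\{1,\dots,N\}$ and returns $j^*\in\arg\max_{j\in\{1,\dots,N\}}\theta_j$. Limited communication MAP: let $\mathcal{N}_i$ be the set consisting of $i$ and its neighbors in the communication graph. Sensor $i$ computes $\theta_{i,j}=\Theta_k(\mathcal{N}_i,W_j)$ for $j\in\mathcal{N}_i$, and $\theta_{i,0}=\Theta_k(\mathcal{N}_i,C)-\sum_{j\in\mathcal{N}_i}\Theta_k(\mathcal{N}_i,W_j)$, corresponding to the hypothesis $H_0$ that the source is outside $\bigcup_{j\in\mathcal{N}_i}W_j$. It returns $j^*\in\arg\max_{j\in\mathcal{N}_i\cup\{0\}}\theta_{i,j}$. ''Converges almost surely to the correct decision'' means that with probability one the decision is correct for all sufficiently large $k$. *)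

(* Defs.v *)
From HB Require Import structures.
From mathcomp Require Import all_boot all_order all_algebra.
From mathcomp Require Import finmap.
From mathcomp Require Import all_classical all_reals all_analysis.
Set Implicit Arguments.
Unset Strict Implicit.
Unset Printing Implicit Defensive.
Import Order.TTheory GRing.Theory Num.Theory.
Import numFieldNormedType.Exports.
Local Open Scope classical_set_scope.
Local Open Scope ring_scope.

Section plane.
Context {R : realType}.
Implicit Types (x y : R * R) (W : set (R * R)).

(* The norm that the library puts on [R * R] is the max norm. *)
Definition eucl_dist x y : R :=
  Num.sqrt ((x.1 - y.1) ^+ 2 + (x.2 - y.2) ^+ 2).

Let line : measurableType _ := measurableTypeR R.

Let length : {sigma_finite_measure set line -> \bar R} := lebesgue_measure.

Definition area : {measure set (line * line)%type -> \bar R} :=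
  (length \x length)%E.

(* A region is the closure of an open set. Without regularity a region could
   have a part of zero area, on which the posterior cannot concentrate. *)
Definition compact_region W : Prop := compact W /\ regclosed W.

Definition collinear (S : set (R * R)) : Prop :=
  exists a b c : R, (a, b) != (0, 0) /\
    forall x, S x -> a * x.1 + b * x.2 = c.

Definition three_noncollinear N (x : 'I_N -> R * R) (M : {set 'I_N}) : Prop :=
  exists i j l : 'I_N, [/\ i \in M, j \in M & l \in M] /\
    ~ collinear [set x i; x j; x l].

End plane.

Section probability.
Context {d : measure_display} {T : measurableType d} {R : realType}.
Variable Pr : probability T R.

Definition mutually_independent (I : choiceType) (X : I -> {RV Pr >-> R}) :
    Prop :=
  forall (J : {fset I}) (B : I -> set R), (forall i, measurable (B i)) ->
    (Pr (\bigcap_(i in [set` J]) (X i @^-1` B i)) =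
     \prod_(i <- J) Pr (X i @^-1` B i))%E.

(* The exceptional set is only required to be contained in a null event, so
   that [D k] need not be measurable. *)
Definition as_eventually_correct (H : Type) (D : nat -> T -> H) (h : H) :
    Prop :=
  {ae Pr, forall w, \forall k \near \oo, D k w = h}.

End probability.

Definition argmax {R : realType} (H : Type) (D : set H) (f : H -> R) : set H :=
  [set h | D h /\ forall h', D h' -> f h' <= f h].

(* [e] is the adjacency relation of the communication graph. *)
Definition neighborhood N (e : rel 'I_N) (i : 'I_N) : {set 'I_N} :=
  [set j | (j == i) || e i j].

Section localization.
Context {R : realType} (P d0 beta : R).
Context {N : nat} (x : 'I_N -> R * R).

Definition mean_log_power (p y : R * R) : R :=
  ln (P * d0 / (d0 + eucl_dist p y `^ beta)).

(* [n i l w] is the noise of sample [l + 1] of sensor [i]. *)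
Definition log_received (T : Type) (s : R * R) (n : 'I_N -> nat -> T -> R)
    (k : nat) (w : T) (i : 'I_N) : R :=
  (\sum_(l < k) (mean_log_power (x i) s + n i l w)) / k%:R.

(* [z i] is the aggregated measurement of sensor [i], [v] its variance. *)
Definition Theta (C : set (R * R)) (v : R) (z : 'I_N -> R)
    (M : {set 'I_N}) (W : set (R * R)) : R :=
  (fine (area C))^-1 *
  \int[area]_(y in W)
    \prod_(l in M) ((Num.sqrt (2 * pi * v))^-1 *
      expR (- ((z l - mean_log_power (x l) y) ^+ 2 / (2 * v)))).

Definition theta_all (C : set (R * R)) (W : 'I_N -> set (R * R))
    (v : R) (z : 'I_N -> R) (j : 'I_N) : R :=
  Theta C v z [set: 'I_N] (W j).

(* [Some j] is the hypothesis that the source is in [W j], and [None] the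
   hypothesis that it is outside the regions of the neighborhood [M]. *)
Definition theta_limited (C : set (R * R)) (W : 'I_N -> set (R * R))
    (v : R) (z : 'I_N -> R) (M : {set 'I_N}) (h : option 'I_N) : R :=
  match h with
  | Some j => Theta C v z M (W j)
  | None => Theta C v z M C - \sum_(j in M) Theta C v z M (W j)
  end.

Definition limited_hypotheses (M : {set 'I_N}) : set (option 'I_N) :=
  [set h | if h is Some j then j \in M else true].

End localization.

(* Main.v *)
Require Import Defs.
From HB Require Import structures.
From mathcomp Require Import all_boot all_order all_algebra.
From mathcomp Require Import finmap ring lra zify.
From mathcomp Require Import all_classical all_reals all_analysis.
From mathcomp Require Import measurable_realfun.
Import Order.TTheory GRing.Theory Num.Theory.
Import numFieldNormedType.Exports.
Local Open Scope classical_set_scope.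
Local Open Scope ring_scope.

(** The posterior concentrates at the source. Three ingredients combine.

    Noise. By the strong law of large numbers the averaged measurement of
    sensor [l] tends almost surely to the noiseless value [f l s], where
    [f l y] is the mean log-power that sensor [l] receives from a source at
    [y] ([ae_average_gaussian_cvg0], [cvg_log_received]). The centered normal law
    is symmetric with a finite second moment, so the independent samples of a
    sensor are uncorrelated with bounded variance, and a law of large numbers
    for such sequences applies ([strong_law_of_uncorrelated]).

    Geometry. [f l] is injective in the distance to [x l], so the noiseless
    misfit [q y = \sum_l (f l s - f l y) ^+ 2] vanishes only at points that
    are as far from every sensor as [s] is. Two distinct points are
    equidistant from all points of one line only, so with three non-collinear
    sensors [q] vanishes only at [s] ([misfit_gt0]).

    Laplace's principle. After [k] samples the integrand of [Theta] is a
    constant times [expR (- k q_k y / (2 sigma ^+ 2))], where the observed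
    misfit [q_k] is comparable to [q]. On a compact region without [s], [q] has a
    positive minimum [a]; near [s], [q] is much smaller than [a], on a set of
    positive area because the region of [s] is the closure of an open set.
    Hence the weight of the region of [s] exceeds any fixed multiple of the
    weight of any other region, eventually in [k] ([region_dominates]).

    Taking the multiple [N + 1], the region of [s] eventually outweighs all
    the other ones together. The weight of the hypothesis [None] is the sum of
    the weights of the regions outside the neighborhood ([Theta_outside]), as
    overlaps have zero area, and comparing weights gives both claims. *)

Set Implicit Arguments.
Unset Strict Implicit.
Unset Printing Implicit Defensive.

(** * The centered normal law *)

Lemma normal_prob_sym (R : realType) (sigma : R) (A : set R) :
  sigma != 0 -> measurable A ->
  normal_prob 0 sigma ((@GRing.opp R) @^-1` A) = normal_prob 0 sigma A.
Proof.
move=> s0 mA; rewrite /normal_prob.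
pose f := fun x : R => (normal_pdf 0 sigma x)%:E.
transitivity (\int[lebesgue_measure]_(x in (-%R : R -> measurableTypeR R) @^-1` A)
    (f \o (-%R : R -> measurableTypeR R)) x)%E.
  apply: eq_integral => y _ /=; rewrite /f !normal_pdfE// /normal_fun !subr0.
  by rewrite sqrrN.
rewrite -ge0_integral_pushforward//=.
- by apply: eq_measure_integral => //= B mB _; exact: lebesgue_measureN.
- apply/measurable_EFinP.
  exact: (measurable_funS _ _ (measurable_normal_pdf 0 sigma)).
- by move=> y _; rewrite lee_fin normal_pdf_ge0.
Qed.

(** The density is a Radon-Nikodym derivative, and those are unique up to null
    sets. *)
Lemma ge0_integral_normal_prob (R : realType) (m sigma : R) (f : R -> R) :
  measurable_fun setT f -> (forall x, 0 <= f x) ->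
  (\int[normal_prob m sigma]_x (f x)%:E =
   \int[lebesgue_measure]_x (f x * normal_pdf m sigma x)%:E)%E.
Proof.
move=> mf f0.
have dom := normal_prob_dominates m sigma.
have mfE : measurable_fun setT (EFin \o f) by exact/measurable_EFinP.
rewrite -(Radon_Nikodym_SigmaFinite.change_of_variables dom)//=.
pose g := Radon_Nikodym_SigmaFinite.f (normal_prob m sigma) lebesgue_measure.
have ig : lebesgue_measure.-integrable setT g.
  exact: Radon_Nikodym_SigmaFinite.f_integrable.
apply: ae_eq_integral => //.
- apply: emeasurable_funM => //; exact: (measurable_int lebesgue_measure).
- apply/measurable_EFinP; apply: measurable_funM => //.
  exact: measurable_normal_pdf.
- have H : ae_eq lebesgue_measure setT g (fun x => (normal_pdf m sigma x)%:E).
    apply: integral_ae_eq => //.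
    + by apply/measurable_EFinP; exact: measurable_normal_pdf.
    + by move=> E _ mE; rewrite -Radon_Nikodym_SigmaFinite.f_integral.
  apply: filterS H => x H0 /H0 /= gx.
  by rewrite EFinM -gx.
Qed.

(** By [t <= expR t], the integrand [x ^+ 2 * normal_pdf 0 sigma x] is bounded
    by a multiple of the normal density of variance [2 * sigma ^+ 2]. *)
Lemma normal_second_moment (R : realType) (sigma : R) : sigma != 0 ->
  (\int[normal_prob 0 sigma]_x (x ^+ 2)%:E < +oo)%E.
Proof.
move=> s0.
rewrite (@ge0_integral_normal_prob R 0 sigma (fun x => x ^+ 2)); last 2 first.
- exact: exprn_measurable.
- by move=> x; exact: sqr_ge0.
pose s' : R := Num.sqrt 2 * sigma.
have s'0 : s' != 0 by rewrite mulf_neq0// sqrtr_eq0 -ltNge.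
pose c := 4 * sigma ^+ 2 * (normal_peak sigma / normal_peak s').
have peak0 : 0 < normal_peak s' by exact: normal_peak_gt0.
have c0 : 0 <= c.
  apply: mulr_ge0; first by apply: mulr_ge0 => //; exact: sqr_ge0.
  by apply: divr_ge0; exact: normal_peak_ge0.
apply: (@le_lt_trans _ _
    (\int[lebesgue_measure]_x (c%:E * (normal_pdf 0 s' x)%:E))%E).
  apply: ge0_le_integral => //=.
  - move=> x _; rewrite lee_fin mulr_ge0 ?sqr_ge0 ?normal_pdf_ge0//.
  - apply/measurable_EFinP; apply: measurable_funM => //.
    exact: measurable_normal_pdf.
  - apply: measurable_funeM; apply/measurable_EFinP.
    exact: measurable_normal_pdf.
  - move=> x _; rewrite -EFinM lee_fin !normal_pdfE// /normal_fun !subr0.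
    rewrite /c.
    have -> : s' ^+ 2 = 2 * sigma ^+ 2 by rewrite exprMn sqr_sqrtr.
    (* With this [t], one factor [expR (- t)] of the density absorbs [x ^+ 2]
       and the other one is the wider density. *)
    pose t := x ^+ 2 / (4 * sigma ^+ 2).
    have s20 : 0 < sigma ^+ 2 by rewrite exprn_even_gt0.
    have -> : - x ^+ 2 / (sigma ^+ 2 *+ 2) = - t - t.
      by rewrite /t; field; rewrite s0.
    have -> : - x ^+ 2 / (2 * sigma ^+ 2 *+ 2) = - t.
      by rewrite /t; field; rewrite s0.
    have -> : x ^+ 2 = 4 * sigma ^+ 2 * t.
      by rewrite /t; field; rewrite s0.
    rewrite expRD.
    have H : t * expR (- t) <= 1.
      rewrite expRN ler_pdivrMr ?expR_gt0// mul1r.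
      by rewrite (le_trans _ (expR_ge1Dx t))// lerDr.
    have -> : 4 * sigma ^+ 2 * (normal_peak sigma / normal_peak s') *
      (normal_peak s' * expR (- t)) = 4 * sigma ^+ 2 * normal_peak sigma *
      expR (- t) by field; rewrite gt_eqF.
    have -> : 4 * sigma ^+ 2 * t *
      (normal_peak sigma * (expR (- t) * expR (- t))) =
      4 * sigma ^+ 2 * normal_peak sigma * expR (- t) * (t * expR (- t)) by ring.
    apply: ler_piMr => //.
    apply: mulr_ge0; last exact: expR_ge0.
    apply: mulr_ge0; last exact: normal_peak_ge0.
    by apply: mulr_ge0 => //; exact: sqr_ge0.
rewrite integralZl//=; last exact: integrable_normal_pdf.
by rewrite integral_normal_pdf mule1 ltry.
Qed.

(** * Uncorrelated noise *)

Section uncorrelated.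
Context d (T : measurableType d) (R : realType) (Pr : probability T R).

Definition square_integrable (X : {RV Pr >-> R}) : Prop :=
  Pr.-integrable setT (fun w => (X w ^+ 2)%:E).

Lemma square_integrable_mul (X Y : {RV Pr >-> R}) :
  square_integrable X -> square_integrable Y ->
  Pr.-integrable setT (fun w => (X w * Y w)%:E).
Proof.
move=> iX iY.
have iXY := integrableD measurableT iX iY.
apply: (le_integrable measurableT _ _ iXY) => /=.
  by apply/measurable_EFinP; exact: measurable_funM.
move=> w _; rewrite lee_fin.
rewrite (ger0_norm (addr_ge0 (sqr_ge0 _) (sqr_ge0 _))).
have := sqr_ge0 (`|X w| - `|Y w|); have := sqr_ge0 (X w).
have := sqr_ge0 (Y w).
rewrite normrM sqrrB !real_normK ?num_real//.
lra.
Qed.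

(** By independence and the symmetry of the law of [X], the pairs [(X, Y)] and
    [(- X, Y)] have the same joint law, namely the product of the marginals, so
    the expectation of [X * Y] equals its opposite. *)
Lemma uncorrelated_of_sym (X Y : {RV Pr >-> R}) :
  square_integrable X -> square_integrable Y ->
  (forall A, measurable A -> Pr ((-%R \o X) @^-1` A) = Pr (X @^-1` A)) ->
  (forall A B, measurable A -> measurable B ->
     Pr (X @^-1` A `&` Y @^-1` B) = (Pr (X @^-1` A) * Pr (Y @^-1` B))%E) ->
  (\int[Pr]_w (X w * Y w)%:E = 0)%E.
Proof.
move=> iX iY symX indep.
have iXY := square_integrable_mul iX iY.
pose XY := fun w => (X w, Y w).
pose NXY := fun w => (- X w, Y w).
have mXY : measurable_fun setT XY by exact: measurable_fun_pair.
have mNXY : measurable_fun setT NXY.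
  by apply: measurable_fun_pair => //; exact: measurableT_comp.
pose f := fun p : R * R => (p.1 * p.2)%:E.
have mf : measurable_fun setT f.
  by apply/measurable_EFinP; exact: measurable_funM.
have E1 : (\int[pushforward Pr XY]_p f p = \int[Pr]_w (X w * Y w)%:E)%E.
  by rewrite (integral_pushforward mXY mf).
have iNXY : Pr.-integrable setT (fun w => (- X w * Y w)%:E).
  under eq_fun do rewrite mulNr EFinN.
  exact: integrableN.
have E2 : (\int[pushforward Pr NXY]_p f p = \int[Pr]_w (- X w * Y w)%:E)%E.
  by rewrite (integral_pushforward mNXY mf).
have E3 : (\int[pushforward Pr XY]_p f p = \int[pushforward Pr NXY]_p f p)%E.
  apply: eq_measure_integral => A mA _.
  pose m1 := distribution Pr X; pose m2 := distribution Pr Y.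
  transitivity ((m1 \x m2)%E A).
    exact/esym/product_measure_unique.
  apply: product_measure_unique => // B1 B2 mB1 mB2.
  have mN : measurable ((@GRing.opp R) @^-1` B1).
    rewrite -[X in measurable X]setTI.
    by have : measurable_fun setT (@GRing.opp R) by []; apply.
  transitivity (Pr (X @^-1` ((@GRing.opp R) @^-1` B1)) * Pr (Y @^-1` B2))%E.
    exact: indep.
  by congr *%E; exact: symX.
move: E3; rewrite E1 E2.
under [in RHS]eq_integral do rewrite mulNr EFinN.
rewrite integralN/=; last exact: integrable_add_def.
have /fineK <- := integrable_fin_num measurableT iXY.
set r := fine _; rewrite -EFinN => -[] H; congr EFin.
lra.
Qed.

End uncorrelated.

(** * The strong law of large numbers *)

Lemma exists_square_interval (N k : nat) : (N.+1 ^ 2 <= k)%N ->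
  exists2 n, (N <= n)%N & (n.+1 ^ 2 <= k < n.+2 ^ 2)%N.
Proof.
move=> Nk.
have ub i : (i.+1 ^ 2 <= k)%N -> (i <= k)%N.
  by move=> ik; apply: leq_trans ik; rewrite expnS expn1 mulnS; lia.
have ex : exists i, (i.+1 ^ 2 <= k)%N by exists N.
have := ex_maxnP ex ub; case=> n nk nmax.
exists n; first exact: nmax.
rewrite nk /= ltnNge; apply/negP => /nmax.
by rewrite ltnn.
Qed.

(** With [S k] the [k]-th partial sum of [a] and [q = n.+1 ^ 2], this is
    [(S q / q) ^+ 2] plus the sum of [((S (q + m) - S q) / q) ^+ 2] over all
    the indices [q + m] up to the next square. It controls all the averages
    [S k / k] of the block [q <= k < n.+2 ^ 2], and its expectation is
    summable in [n] for uncorrelated samples, whereas the squared average at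
    [k] may have an expectation of order [1 / k]. *)
Definition square_block_bound (R : realType) (a : nat -> R) (n : nat) : R :=
  let q := (n.+1 ^ 2)%N in
  ((\sum_(i < q) a i) / q%:R) ^+ 2 +
  \sum_(m < n.*2.+3) ((\sum_(i < m) a (q + i)%N) / q%:R) ^+ 2.

(** For [q <= k < n.+2 ^ 2], [`|S k / k|] is at most
    [`|S q / q| + `|(S k - S q) / q|], and the square of either term is a
    summand of [square_block_bound a n]. *)
Lemma cvg_average_of_square_blocks (R : realType) (a : nat -> R) :
  square_block_bound a @ \oo --> (0 : R) ->
  (\sum_(i < k) a i) / k%:R @[k --> \oo] --> (0 : R).
Proof.
move=> /cvgr0Pnorm_lt Y0; apply/cvgr0Pnorm_lt => e e0.
have e2 : 0 < (e / 2) ^+ 2 by rewrite exprn_gt0// divr_gt0.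
have [N _ YN] := Y0 _ e2.
exists (N.+1 ^ 2)%N => // k /= Nk.
have [n Nn /andP[nk kn]] := exists_square_interval Nk.
have := YN n Nn.
rewrite /square_block_bound.
set q := (n.+1 ^ 2)%N in nk *.
have q0 : 0 < q%:R :> R by rewrite ltr0n expn_gt0.
have mlt : (k - q < n.*2.+3)%N.
  rewrite /q -muln2 !expnS expn0 !muln1 in nk kn *; lia.
set A := \sum_(i < q) a i.
rewrite (bigD1 (Ordinal mlt))//=.
set B := \sum_(i < k - q) a (q + i)%N.
set C := \sum_(_ < _ | _) _.
have C0 : 0 <= C by apply: sumr_ge0 => i _; exact: sqr_ge0.
rewrite ger0_norm; last by rewrite !addr_ge0// sqr_ge0.
move=> Ylt.
have half (z : R) : z ^+ 2 < (e / 2) ^+ 2 -> `|z| < e / 2.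
  rewrite -(real_normK (num_real z)) ltr_sqr// nnegrE.
  by rewrite divr_ge0// ltW.
have Ae : `|A / q%:R| < e / 2.
  apply: half; apply: le_lt_trans Ylt.
  by have := sqr_ge0 (B / q%:R); lra.
have Be : `|B / q%:R| < e / 2.
  apply: half; apply: le_lt_trans Ylt.
  by have := sqr_ge0 (A / q%:R); lra.
have -> : \sum_(i < k) a i = A + B.
  by rewrite /A /B -[X in \sum_(i < X) a i](subnKC nk) big_split_ord.
have k0 : 0 < k%:R :> R by apply: lt_le_trans q0 _; rewrite ler_nat.
rewrite normrM normfV (gtr0_norm k0).
apply: (@le_lt_trans _ _ (`|A + B| / q%:R)).
  by rewrite ler_wpM2l// lef_pV2 ?posrE// ler_nat.
rewrite -(gtr0_norm q0) -normfV -normrM mulrDl.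
apply: le_lt_trans (ler_normD _ _) _; lra.
Qed.

(** By monotone convergence the series of the [Y n] has a finite integral, so it
    converges almost everywhere and its terms tend to zero. *)
Lemma ae_cvg0_of_summable_integral d (T : measurableType d) (R : realType)
    (Pr : probability T R) (Y : nat -> T -> R) :
  (forall n, measurable_fun setT (Y n)) -> (forall n w, 0 <= Y n w) ->
  (\sum_(0 <= n <oo) \int[Pr]_w (Y n w)%:E < +oo)%E ->
  {ae Pr, forall w, Y ^~ w @ \oo --> (0 : R)}.
Proof.
move=> mY Y0 sumY.
pose f w := (\sum_(0 <= n <oo) (Y n w)%:E)%E.
have mYE n : measurable_fun setT (fun w => (Y n w)%:E) by exact/measurable_EFinP.
have YE0 n w : (0 <= (Y n w)%:E)%E by rewrite lee_fin.
have f0 w : (0 <= f w)%E by exact: nneseries_ge0.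
have intf : Pr.-integrable setT f.
  apply/integrableP; split.
    by apply: ge0_emeasurable_sum.
  under eq_integral do rewrite gee0_abs//.
  by rewrite integral_nneseries.
apply: filterS (integrable_ae measurableT intf) => w /(_ I) fin.
apply: cvg_series_cvg_0; apply: nnseries_is_cvg => //.
by move: fin; rewrite (ge0_fin_numE (f0 w)).
Qed.

Section strong_law.
Context d (T : measurableType d) (R : realType) (Pr : probability T R).
Variables (X : nat -> {RV Pr >-> R}) (M : R).
Hypothesis iX : forall i, square_integrable (X i).
Hypothesis boundX : forall i, (\int[Pr]_w (X i w ^+ 2)%:E <= M%:E)%E.
Hypothesis uncorX :
  forall i j, i != j -> (\int[Pr]_w (X i w * X j w)%:E = 0)%E.

Lemma block_second_moment a m :
  (\int[Pr]_w ((\sum_(i < m) X (a + i)%N w) ^+ 2)%:E <= (m%:R * M)%:E)%E.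
Proof.
have iXX i j : Pr.-integrable setT (fun w => (X i w * X j w)%:E).
  exact: square_integrable_mul.
under eq_integral do rewrite expr2 big_distrlr /= -sumEFin.
under eq_integral do under eq_bigr do rewrite -sumEFin.
rewrite integral_sum//=; last first.
  by move=> i; apply: integrable_sum => //= j _; exact: iXX.
have -> : (m%:R * M)%:E = (\sum_(i < m) M%:E)%E.
  by rewrite sumEFin sumr_const card_ord mulr_natl.
apply: lee_sum => i _.
rewrite integral_sum//= (bigD1 i)//= big1 => [|j ji]; last first.
  by rewrite uncorX// eqn_add2l eq_sym.
by rewrite adde0; under eq_integral do rewrite -expr2.
Qed.

Lemma measurable_block a m :
  measurable_fun setT (fun w => \sum_(i < m) X (a + i)%N w).
Proof. by apply: measurable_sum. Qed.

Lemma block_average_second_moment a m (q : R) : 0 < q ->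
  (\int[Pr]_w (((\sum_(i < m) X (a + i)%N w) / q) ^+ 2)%:E <=
   (m%:R * M / q ^+ 2)%:E)%E.
Proof.
move=> q0.
under eq_integral do rewrite expr_div_n mulrC EFinM.
rewrite ge0_integralZl//=; last 3 first.
- apply/measurable_EFinP; apply: measurable_funX; exact: measurable_block.
- by move=> w _; rewrite lee_fin sqr_ge0.
- by rewrite lee_fin invr_ge0 sqr_ge0.
rewrite [(m%:R * M / _)]mulrC EFinM lee_wpmul2l ?block_second_moment//.
by rewrite lee_fin invr_ge0 sqr_ge0.
Qed.

Let M0 : 0 <= M.
Proof.
rewrite -lee_fin; apply: le_trans (boundX 0%N).
by apply: integral_ge0 => w _; rewrite lee_fin sqr_ge0.
Qed.

Let Y n w : R := square_block_bound (fun i => X i w) n.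

Let mterm a m (q : R) :
  measurable_fun setT (fun w => ((\sum_(i < m) X (a + i)%N w) / q) ^+ 2).
Proof.
apply: measurable_funX; apply: measurable_funM => //; exact: measurable_block.
Qed.

Let mY n : measurable_fun setT (Y n).
Proof.
apply: measurable_funD; first exact: (mterm 0).
by apply: measurable_sum => m; exact: mterm.
Qed.

Let Y0 n w : 0 <= Y n w.
Proof. by rewrite addr_ge0 ?sqr_ge0// sumr_ge0// => m _; exact: sqr_ge0. Qed.

(* The block has [2 n + 3 <= 3 (n + 1)] terms, each of second moment at most
   [(2 n + 3) M / (n + 1) ^ 4]: hence the factor [1 + 9]. *)
Let intY n : (\int[Pr]_w (Y n w)%:E <= (10 * M / n.+1%:R ^+ 2)%:E)%E.
Proof.
rewrite /Y /square_block_bound.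
set q := (n.+1 ^ 2)%N.
have qE : q%:R = n.+1%:R ^+ 2 :> R by rewrite natrX.
have q0 : 0 < q%:R :> R by rewrite ltr0n expn_gt0.
under eq_integral do rewrite EFinD -sumEFin.
rewrite ge0_integralD//=; last 4 first.
- by move=> w _; rewrite lee_fin sqr_ge0.
- by apply/measurable_EFinP; exact: (mterm 0).
- by move=> w _; apply: sume_ge0 => m _; rewrite lee_fin sqr_ge0.
- apply: emeasurable_sum => m; apply/measurable_EFinP; exact: mterm.
rewrite ge0_integral_sum//=; last 2 first.
- by move=> m; apply/measurable_EFinP; exact: mterm.
- by move=> m w _; rewrite lee_fin sqr_ge0.
apply: (@le_trans _ _ ((q%:R * M / q%:R ^+ 2)%:E +
    \sum_(m < n.*2.+3) (n.*2.+3%:R * M / q%:R ^+ 2)%:E)%E).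
  apply: leeD; first exact: (block_average_second_moment 0).
  apply: lee_sum => m _.
  apply: le_trans (block_average_second_moment _ _ q0) _.
  rewrite lee_fin ler_wpM2r ?invr_ge0 ?sqr_ge0// ler_wpM2r// ler_nat.
  exact: ltnW.
rewrite sumEFin sumr_const card_ord -EFinD lee_fin -[X in _ + X <= _]mulr_natl qE.
set N : R := n.+1%:R.
have N0 : 0 < N by rewrite ltr0n.
have L : n.*2.+3%:R <= 3 * N.
  by rewrite /N -natrM ler_nat -muln2; lia.
set L' : R := n.*2.+3%:R in L *.
have L0 : 0 <= L' by rewrite ler0n.
have -> : N ^+ 2 * M / (N ^+ 2) ^+ 2 + L' * (L' * M / (N ^+ 2) ^+ 2) =
  (N ^+ 2 + L' ^+ 2) * (M / (N ^+ 2) ^+ 2).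
  by field; rewrite gt_eqF.
have -> : 10 * M / N ^+ 2 = (10 * N ^+ 2) * (M / (N ^+ 2) ^+ 2).
  by field; rewrite gt_eqF.
rewrite ler_wpM2r ?divr_ge0 ?sqr_ge0//.
have : L' ^+ 2 <= (3 * N) ^+ 2 by rewrite ler_sqr ?nnegrE// mulr_ge0// ltW.
rewrite exprMn; lra.
Qed.

Let sumY : (\sum_(0 <= n <oo) \int[Pr]_w (Y n w)%:E < +oo)%E.
Proof.
apply: (@le_lt_trans _ _ (20 * M)%:E); last exact: ltry.
have pos n : (0 <= \int[Pr]_w (Y n w)%:E)%E.
  by apply: integral_ge0 => w _; rewrite lee_fin.
apply: lime_le; first exact: is_cvg_nneseries.
near=> n.
(* The partial sums telescope, as
   [(n + 1) ^- 2 <= 2 / (n + 1) - 2 / (n + 2)]. *)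
apply: (@le_trans _ _ (20 * M * (1 - n.+1%:R^-1))%:E); last first.
  by rewrite lee_fin ler_piMr ?mulr_ge0// gerBl invr_ge0.
elim: (n) => [|m IH]; first by rewrite big_geq// invr1 subrr mulr0.
rewrite big_nat_recr//=.
apply: le_trans (leeD IH (intY m)) _.
rewrite -EFinD lee_fin; clear IH.
set N : R := m.+1%:R.
have N1 : 1 <= N by rewrite ler1n.
have -> : m.+2%:R = N + 1 :> R by rewrite /N -natr1.
rewrite -subr_ge0.
have -> : 20 * M * (1 - (N + 1)^-1) - (20 * M * (1 - N^-1) + 10 * M / N ^+ 2) =
  10 * M * (N - 1) / (N ^+ 2 * (N + 1)) by field; lra.
rewrite divr_ge0// ?mulr_ge0// ?sqr_ge0//; lra.
Unshelve. all: by end_near. Qed.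

(** The second moment of a sum of [m] samples is at most [m * M], so that
    [square_block_bound] is summable in expectation, hence tends to zero almost
    surely. *)
Theorem strong_law_of_uncorrelated :
  {ae Pr, forall w, (\sum_(i < k) X i w) / k%:R @[k --> \oo] --> (0 : R)}.
Proof.
apply: filterS (ae_cvg0_of_summable_integral mY Y0 sumY) => w.
exact: cvg_average_of_square_blocks.
Qed.

End strong_law.

(** * Averages of Gaussian samples *)

Section gaussian_noise.
Context d (T : measurableType d) (R : realType) (Pr : probability T R).

Lemma independent_pair (I : choiceType) (X : I -> {RV Pr >-> R}) (i j : I)
    (A B : set R) :
  mutually_independent X -> i != j -> measurable A -> measurable B ->
  Pr (X i @^-1` A `&` X j @^-1` B) = (Pr (X i @^-1` A) * Pr (X j @^-1` B))%E.
Proof.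
move=> indep ij mA mB.
have mF l : measurable (if l == i then A else B) by case: ifP.
have := indep [fset i; j]%fset (fun l => if l == i then A else B) mF.
rewrite big_fsetU1 ?inE//= big_seq_fset1 eqxx eq_sym (negbTE ij) => <-.
congr (Pr _); apply/seteqP; split => [w [Xi Xj] l /=|w Xw].
  by rewrite !inE => /orP[] /eqP ->; rewrite ?eqxx// eq_sym (negbTE ij).
split.
  by have /= := Xw i; rewrite !inE eqxx => /(_ isT).
by have /= := Xw j; rewrite !inE eqxx orbT eq_sym (negbTE ij) => /(_ isT).
Qed.

Variables (sigma : R) (sigma0 : sigma != 0).

Lemma gaussian_second_moment (X : {RV Pr >-> R}) :
  (forall B : set R, measurable B ->
     distribution Pr X B = normal_prob 0 sigma B) ->
  (\int[Pr]_w (X w ^+ 2)%:E = \int[normal_prob 0 sigma]_x (x ^+ 2)%:E)%E.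
Proof.
move=> gaussX.
have mX : measurable_fun setT (X : T -> measurableTypeR R).
  by move=> mT A mA; exact: (measurable_funP X).
rewrite -(@eq_measure_integral _ _ _ _ (normal_prob 0 sigma)
  (pushforward Pr (X : T -> measurableTypeR R))); last first.
  by move=> A mA _; exact: gaussX.
rewrite (ge0_integral_pushforward mX)//.
  by apply/measurable_EFinP; exact: exprn_measurable.
by move=> y _; rewrite lee_fin sqr_ge0.
Qed.

Lemma ae_average_gaussian_cvg0 (X : nat -> {RV Pr >-> R}) :
  (forall l B, measurable B ->
     distribution Pr (X l) B = normal_prob 0 sigma B) ->
  (forall i j A B, i != j -> measurable A -> measurable B ->
     Pr (X i @^-1` A `&` X j @^-1` B) =
     (Pr (X i @^-1` A) * Pr (X j @^-1` B))%E) ->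
  {ae Pr, forall w, (\sum_(l < k) X l w) / k%:R @[k --> \oo] --> (0 : R)}.
Proof.
move=> gaussX indepX.
have m2 := normal_second_moment sigma0.
have m2_fin : (\int[normal_prob 0 sigma]_x (x ^+ 2)%:E)%E \is a fin_num.
  by rewrite ge0_fin_numE//; apply: integral_ge0 => x _; rewrite lee_fin sqr_ge0.
have iX l : square_integrable (X l).
  apply/integrableP; split.
    by apply/measurable_EFinP; exact: measurable_funX.
  under eq_integral do rewrite gee0_abs ?lee_fin ?sqr_ge0//.
  by rewrite (gaussian_second_moment (gaussX l)).
apply: (@strong_law_of_uncorrelated _ _ _ _ X
  (fine (\int[normal_prob 0 sigma]_x (x ^+ 2)%:E)%E)) => //.
  by move=> l; rewrite fineK// (gaussian_second_moment (gaussX l)).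
move=> i j ij; apply: uncorrelated_of_sym => // [A mA|A B mA mB].
  have mN : measurable ((@GRing.opp R) @^-1` A).
    rewrite -[Z in measurable Z]setTI.
    by have : measurable_fun setT (@GRing.opp R) by []; apply.
  transitivity (normal_prob 0 sigma ((@GRing.opp R) @^-1` A)).
    exact: (gaussX i _ mN).
  by rewrite normal_prob_sym//; apply/esym; exact: gaussX.
exact: indepX.
Qed.

End gaussian_noise.

(** * Area, and the mean received power *)

Section plane_area.
Context (R : realType).
Local Notation line := (measurableTypeR R).

(** The area is a measure on the product of two copies of the Borel
    sigma-algebra; open sets belong to it because each one is a countable
    union of squares with rational centers. *)
Lemma open_measurable_plane (U : set (line * line)) :
  open (U : set (R * R)) -> measurable U.
Proof.
move=> oU.
pose box (p q : rat) (n : nat) : set (line * line) :=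
  ball (ratr p : R) n.+1%:R^-1 `*` ball (ratr q : R) n.+1%:R^-1.
pose F p q n : set (line * line) :=
  if `[< box p q n `<=` U >] then box p q n else set0.
have -> : U = \bigcup_p \bigcup_q \bigcup_n F p q n.
  apply/seteqP; split => [x Ux|x [p _ [q _ [n _]]]]; last first.
    by rewrite /F; case: asboolP => // sub /sub.
  have /nbhs_ballP[e /= e0 xeU] : nbhs (x : R * R) U.
    by apply: open_nbhs_nbhs; split.
  pose n := Num.truncn (2 / e).
  have n1e : n.+1%:R^-1 < e / 2 :> R.
    rewrite invf_plt ?posrE ?divr_gt0// invf_div.
    exact: truncnS_gt.
  have n0 : 0 < n.+1%:R^-1 :> R by rewrite invr_gt0.
  set h : R := n.+1%:R^-1 in n0 n1e.
  have approx (r : R) : exists p : rat, `|ratr p - r| < h.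
    have /rat_in_itvoo[p] : r - h < r + h by lra.
    rewrite in_itv/= => rp; exists p.
    by rewrite ltr_distl.
  have [p xp] := approx x.1; have [q xq] := approx x.2.
  exists p => //; exists q => //; exists n => //.
  rewrite /F asboolT; first by split.
  move=> y [yp yq]; apply: xeU; split; rewrite /ball/= /ball_/= -/h in yp yq *.
    have -> : x.1 - y.1 = - (ratr p - x.1) + (ratr p - y.1) by ring.
    by apply: le_lt_trans (ler_normD _ _) _; rewrite normrN; lra.
  have -> : x.2 - y.2 = - (ratr q - x.2) + (ratr q - y.2) by ring.
  by apply: le_lt_trans (ler_normD _ _) _; rewrite normrN; lra.
apply: bigcupT_measurable_rat => p; apply: bigcupT_measurable_rat => q.
apply: bigcupT_measurable => n; rewrite /F.
case: asboolP => _; last exact: measurable0.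
by apply: measurableX; exact: measurable_ball.
Qed.

Lemma compact_measurable_plane (K : set (line * line)) :
  compact (K : set (R * R)) -> measurable K.
Proof.
move=> cK; rewrite -[K]setCK; apply: measurableC.
apply: open_measurable_plane; apply: closed_openC.
by apply: compact_closed cK; exact: norm_hausdorff.
Qed.

Lemma area_open_gt0 (U : set (R * R)) :
  open U -> U !=set0 -> (0 < area U)%E.
Proof.
move=> oU [x Ux].
have /nbhs_ballP[e /= e0 xeU] : nbhs x U by exact: open_nbhs_nbhs.
have mb (r : R) : measurable (ball r e : set line) by exact: measurable_ball.
pose B : set (line * line) := ball x.1 e `*` ball x.2 e.
have mB : measurable B by exact: measurableX.
apply: (@lt_le_trans _ _ (area B)).
  have -> : area B = (lebesgue_measure (ball x.1 e : set line) *
      lebesgue_measure (ball x.2 e : set line))%E.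
    exact: product_measure1E.
  rewrite !lebesgue_measure_ball ?ltW//.
  by rewrite -EFinM lte_fin mulr_gt0 ?mulrn_wgt0.
by apply: le_measure; rewrite ?inE//; exact: open_measurable_plane.
Qed.

Lemma area_compact_fin (K : set (R * R)) : compact K -> (area K < +oo)%E.
Proof.
move=> cK; have mK := compact_measurable_plane cK.
have [M [_ KM]] := compact_bounded cK.
pose r : R := `|M| + 1; pose o : R := 0.
have r0 : 0 < r by rewrite ltr_pwDr.
have mb : measurable (closed_ball o r : set line).
  exact: measurable_closed_ball.
pose B : set (line * line) := closed_ball o r `*` closed_ball o r.
have mB : measurable B by exact: measurableX.
apply: (@le_lt_trans _ _ (area B)).
  apply: le_measure; rewrite ?inE// => y Ky.
  have yr : `|y| <= r by apply: (KM r) => //; rewrite /r ltr_pwDr// ler_norm.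
  have [y1 y2] : `|y.1| <= r /\ `|y.2| <= r.
    by move: yr; rewrite prod_normE ge_max => /andP.
  by split; rewrite closed_ballE//= /closed_ball_/= sub0r normrN.
have -> : area B = (lebesgue_measure (closed_ball o r : set line) *
    lebesgue_measure (closed_ball o r : set line))%E.
  exact: product_measure1E.
rewrite !lebesgue_measure_closed_ball ?ltW//.
by rewrite -EFinM ltry.
Qed.

(** The absolute value extends [powR ^~ b] to a function that is continuous on
    the whole line, at zero as well. *)
Lemma continuous_norm_powR (b : R) : 1 <= b ->
  continuous (fun r : R => `|r| `^ b).
Proof.
move=> b1 r; have [->|r0] := eqVneq r 0; last first.
  apply: (@continuous_comp _ _ _ (fun r : R => `|r|) (fun a => a `^ b)).
    exact: norm_continuous.
  apply: differentiable_continuous; apply/derivable1_diffP.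
  by apply: derivable_powR; rewrite in_itv/= andbT normr_gt0.
rewrite /continuous_at normr0 powR0 ?gt_eqF//; last by lra.
apply/cvgrPdist_lt => e e0.
near=> t.
rewrite sub0r normrN ger0_norm ?powR_ge0//.
have t1 : `|t| < Num.min 1 e.
  rewrite -[t]subr0 distrC; near: t; apply/nbhs_ballP.
  by exists (Num.min 1 e) => //=; rewrite lt_min ltr01.
move: t1; rewrite lt_min => /andP[t1 te].
have [->|t0] := eqVneq t 0; first by rewrite normr0 powR0//; lra.
apply: le_lt_trans te; apply: ge1r_powR => //.
by rewrite normr_gt0 t0 ltW.
Unshelve. all: by end_near. Qed.

End plane_area.

Section mean_power.
Context (R : realType) (P d0 beta : R).
Hypotheses (P0 : 0 < P) (d00 : 0 < d0) (beta2 : 2 < beta).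
Local Notation line := (measurableTypeR R).
Implicit Types p y : R * R.

Lemma eucl_dist_ge0 p y : 0 <= eucl_dist p y. Proof. exact: sqrtr_ge0. Qed.

Lemma continuous_eucl_dist p : continuous (eucl_dist p).
Proof.
move=> y; rewrite /eucl_dist.
apply: (@continuous_comp _ _ _
  (fun y => (p.1 - y.1) ^+ 2 + (p.2 - y.2) ^+ 2) (@Num.sqrt R)); last first.
  exact: sqrt_continuous.
have sq (f : R * R -> R) :
    {for y, continuous f} -> {for y, continuous (fun z => f z ^+ 2)}.
  move=> cf; apply: (@continuous_comp _ _ _ f (fun a : R => a ^+ 2)) => //.
  exact: exprn_continuous.
apply: cvgD.
- by apply: sq; apply: cvgB; [exact: cvg_cst|exact: cvg_fst].
- by apply: sq; apply: cvgB; [exact: cvg_cst|exact: cvg_snd].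
Qed.

Let beta1 : 1 <= beta.
Proof. by apply: le_trans (ltW beta2); rewrite ler1n. Qed.

Let ratio_gt0 r : 0 < P * d0 / (d0 + r `^ beta).
Proof. by rewrite divr_gt0 ?mulr_gt0// ltr_pwDl ?powR_ge0. Qed.

Lemma continuous_mean_log_power p : continuous (mean_log_power P d0 beta p).
Proof.
move=> y.
pose h (r : R) := ln (P * d0 / (d0 + `|r| `^ beta)).
have -> : mean_log_power P d0 beta p = h \o eucl_dist p.
  by apply/funext => z; rewrite /mean_log_power /h/= ger0_norm// eucl_dist_ge0.
apply: continuous_comp; first exact: continuous_eucl_dist.
rewrite /h; apply: (@continuous_comp _ _ _
  (fun r : R => P * d0 / (d0 + `|r| `^ beta)) (@ln R)); last exact: continuous_ln.
apply: cvgM; first exact: cvg_cst.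
apply: cvgV; first by rewrite gt_eqF// ltr_pwDl ?powR_ge0.
apply: cvgD; first exact: cvg_cst.
exact: continuous_norm_powR.
Qed.

Lemma measurable_mean_log_power p :
  measurable_fun [set: line * line] (mean_log_power P d0 beta p).
Proof.
apply: measurableT_comp; first exact: measurable_ln.
apply: measurable_funM => //.
have mV : measurable_fun [set: R] (fun x : R => (d0 + `|x|)^-1).
  apply: continuous_measurable_fun => x; apply: cvgV.
    by rewrite gt_eqF// ltr_pwDl.
  by apply: cvgD; [exact: cvg_cst|exact: norm_continuous].
have -> : (fun y : line * line => (d0 + eucl_dist p y `^ beta)^-1) =
    (fun x : R => (d0 + `|x|)^-1) \o (fun y => eucl_dist p y `^ beta).
  by apply/funext => y /=; rewrite ger0_norm// powR_ge0.
apply: measurableT_comp => //.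
apply: (measurableT_comp (measurable_powR _)).
apply: (measurableT_comp (f := @Num.sqrt R)).
  by apply: continuous_measurable_fun; exact: sqrt_continuous.
by apply: measurable_funD; apply: measurable_funX; apply: measurable_funB.
Qed.

Lemma mean_log_power_inj p y s :
  mean_log_power P d0 beta p y = mean_log_power P d0 beta p s ->
  eucl_dist p y = eucl_dist p s.
Proof.
move=> /ln_inj; rewrite !posrE => /(_ (ratio_gt0 _) (ratio_gt0 _)).
move=> /(mulfI (lt0r_neq0 (mulr_gt0 P0 d00)))/invr_inj/addrI.
by apply: powR_injective; rewrite ?nnegrE ?eucl_dist_ge0// (lt_le_trans _ beta1).
Qed.

Lemma eucl_dist_sqr p y :
  eucl_dist p y ^+ 2 = (p.1 - y.1) ^+ 2 + (p.2 - y.2) ^+ 2.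
Proof. by rewrite sqr_sqrtr// addr_ge0// sqr_ge0. Qed.

(** Expanding the squared distances, the quadratic terms in [p] cancel: the
    points equidistant from [y] and [s] form their perpendicular bisector. *)
Lemma equidistant_collinear (y s : R * R) : y != s ->
  collinear [set p | eucl_dist p y = eucl_dist p s].
Proof.
move=> ys.
exists (2 * (s.1 - y.1)), (2 * (s.2 - y.2)),
  (s.1 ^+ 2 + s.2 ^+ 2 - y.1 ^+ 2 - y.2 ^+ 2); split.
  apply: contra ys => /eqP[e1 e2]; rewrite [y]surjective_pairing.
  by rewrite [s]surjective_pairing; apply/eqP; congr pair; lra.
move=> p /= /(congr1 (fun r => r ^+ 2)); rewrite !eucl_dist_sqr => H.
move: H; rewrite !expr2; lra.
Qed.

End mean_power.

(** * Bounds on the posterior weight of a region *)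

Section likelihood.
Context (R : realType) (P d0 beta : R).
Hypothesis d00 : 0 < d0.
Context (N : nat) (x : 'I_N -> R * R).
Local Notation line := (measurableTypeR R).
Local Notation f := (fun l => mean_log_power P d0 beta (x l)).
Implicit Types (z : 'I_N -> R) (M : {set 'I_N}) (y : R * R) (K : set (R * R)).

Definition misfit z M y : R := \sum_(l in M) (z l - f l y) ^+ 2.

Definition likelihood (v : R) z M y : R :=
  \prod_(l in M) ((Num.sqrt (2 * pi * v))^-1 *
    expR (- ((z l - f l y) ^+ 2 / (2 * v)))).

Lemma likelihoodE v z M y : likelihood v z M y =
  (Num.sqrt (2 * pi * v))^-1 ^+ #|M| * expR (- (misfit z M y / (2 * v))).
Proof.
rewrite /likelihood big_split/= prodr_const -expR_sum /misfit.
by rewrite sumrN mulr_suml.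
Qed.

Lemma likelihood_ge0 v z M y : 0 <= likelihood v z M y.
Proof. by rewrite likelihoodE mulr_ge0 ?expR_ge0// exprn_ge0// invr_ge0. Qed.

Lemma measurable_likelihood v z M :
  measurable_fun [set: line * line] (likelihood v z M).
Proof.
have -> : likelihood v z M = fun y =>
    (Num.sqrt (2 * pi * v))^-1 ^+ #|M| * expR (- (misfit z M y / (2 * v))).
  by apply/funext => y; rewrite likelihoodE.
apply: measurable_funM => //; apply: measurableT_comp => //.
apply: measurable_funN; apply: measurable_funM => //.
rewrite /misfit; under eq_fun do rewrite big_mkcond/=.
apply: measurable_sum => l; case: (l \in M) => //.
apply: measurable_funX; apply: measurable_funB => //.
exact: measurable_mean_log_power.
Qed.

Lemma misfit_ge0 z M y : 0 <= misfit z M y.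
Proof. by apply: sumr_ge0 => l _; exact: sqr_ge0. Qed.

Lemma integrable_likelihood v z M K : 0 < v -> measurable (K : set (line * line)) ->
  (area K < +oo)%E -> area.-integrable K (EFin \o likelihood v z M).
Proof.
move=> v0 mK Kfin; apply: measurable_bounded_integrable => //.
  by apply: measurable_funTS; exact: measurable_likelihood.
exists ((Num.sqrt (2 * pi * v))^-1 ^+ #|M|); split; first exact: num_real.
move=> B ltB y _ /=; apply: le_trans (ltW ltB).
rewrite ger0_norm ?likelihood_ge0// likelihoodE ler_piMr//.
rewrite -[leRHS]expR0 ler_expR oppr_le0 divr_ge0 ?misfit_ge0//.
by rewrite mulr_ge0// ltW.
Qed.

Variables (C : set (R * R)).
Hypothesis C0 : 0 < fine (area C).
Local Notation Theta := (Theta P d0 beta x C).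

Lemma ThetaE v z M K :
  Theta v z M K = (fine (area C))^-1 * \int[area]_(y in K) likelihood v z M y.
Proof. by []. Qed.

Lemma Theta_ge0 v z M K : 0 <= Theta v z M K.
Proof.
rewrite ThetaE mulr_ge0 ?invr_ge0 ?(ltW C0)//.
by apply: Rintegral_ge0 => y _; exact: likelihood_ge0.
Qed.

Lemma Theta_le v z M K b : 0 < v -> measurable (K : set (line * line)) ->
  (area K < +oo)%E -> (forall y, K y -> b <= misfit z M y) ->
  Theta v z M K <= (fine (area C))^-1 *
    ((Num.sqrt (2 * pi * v))^-1 ^+ #|M| * expR (- (b / (2 * v))) *
     fine (area K)).
Proof.
move=> v0 mK Kfin bK; rewrite ThetaE ler_wpM2l ?invr_ge0 ?(ltW C0)//.
rewrite -Rintegral_cst//; apply: le_Rintegral => //.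
- exact: integrable_likelihood.
- apply: (measurable_bounded_integrable mK) => //.
  by apply: bounded_cst.
- move=> y Ky; rewrite likelihoodE ler_wpM2l ?exprn_ge0 ?invr_ge0//.
  by rewrite ler_expR lerN2 ler_pM2r ?bK// invr_gt0 mulr_gt0.
Qed.

Lemma Theta_ge v z M K V a : 0 < v -> measurable (K : set (line * line)) ->
  (area K < +oo)%E -> measurable (V : set (line * line)) -> V `<=` K ->
  (forall y, V y -> misfit z M y <= a) ->
  (fine (area C))^-1 *
    ((Num.sqrt (2 * pi * v))^-1 ^+ #|M| * expR (- (a / (2 * v))) *
     fine (area V)) <= Theta v z M K.
Proof.
move=> v0 mK Kfin mV VK aV; rewrite ThetaE ler_wpM2l ?invr_ge0 ?(ltW C0)//.
have Vfin : (area V < +oo)%E.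
  by apply: le_lt_trans Kfin; apply: le_measure; rewrite ?inE.
apply: (@le_trans _ _ (\int[area]_(y in V) likelihood v z M y)).
  rewrite -Rintegral_cst//; apply: le_Rintegral => //.
  - by apply: (measurable_bounded_integrable mV) => //; exact: bounded_cst.
  - exact: integrable_likelihood.
  - move=> y Vy; rewrite likelihoodE ler_wpM2l ?exprn_ge0 ?invr_ge0//.
    by rewrite ler_expR lerN2 ler_pM2r ?aV// invr_gt0 mulr_gt0.
rewrite /Rintegral fine_le//.
- exact: integrable_fin_num (integrable_likelihood _ _ _ _ _).
- exact: integrable_fin_num (integrable_likelihood _ _ _ _ _).
- apply: ge0_subset_integral => //.
    apply/measurable_EFinP; apply: measurable_funTS.
    exact: measurable_likelihood.
  by move=> y _; rewrite lee_fin likelihood_ge0.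
Qed.

End likelihood.

(** * Integrals over almost disjoint unions *)

Section almost_disjoint.
Context d (T : measurableType d) (R : realType)
  (mu : {measure set T -> \bar R}).

Lemma Rintegral_setU_null (A B : set T) (h : T -> R) :
  measurable A -> measurable B -> mu.-integrable (A `|` B) (EFin \o h) ->
  mu (A `&` B) = 0%E ->
  \int[mu]_(x in A `|` B) h x = \int[mu]_(x in A) h x + \int[mu]_(x in B) h x.
Proof.
move=> mA mB ih AB0.
have AB : A `|` B = A `|` (B `\` A) by rewrite setDE setUIr setUv setIT.
have iB : mu.-integrable B (EFin \o h).
  by apply: integrableS ih => //; exact: measurableU.
rewrite AB Rintegral_setU//; last 3 first.
- exact: measurableD.
- by rewrite -AB.
- by rewrite disj_set2E setDIK.
congr (_ + _); rewrite /Rintegral; congr fine.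
rewrite [RHS](negligible_integral (measurableI _ _ mA mB) mB iB AB0).
by congr (integral _ _ _); rewrite setDIr setDv setU0.
Qed.

Lemma null_setI_bigsetU (I : eqType) (s : seq I) (A : set T) (W : I -> set T) :
  measurable A -> (forall i, measurable (W i)) ->
  (forall i, i \in s -> mu (A `&` W i) = 0%E) ->
  mu (A `&` \big[setU/set0]_(i <- s) W i) = 0%E.
Proof.
move=> mA mW; elim: s => [|i s IH] AW0; first by rewrite big_nil setI0 measure0.
rewrite big_cons setIUr measureU0 ?AW0 ?mem_head//.
- exact: measurableI.
- by apply: measurableI => //; exact: bigsetU_measurable.
- by apply: IH => j js; rewrite AW0// in_cons js orbT.
Qed.

Lemma Rintegral_bigsetU_null (I : eqType) (s : seq I) (W : I -> set T)
    (h : T -> R) :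
  uniq s -> (forall i, measurable (W i)) ->
  (forall i j, i != j -> mu (W i `&` W j) = 0%E) ->
  mu.-integrable (\big[setU/set0]_(i <- s) W i) (EFin \o h) ->
  \int[mu]_(x in \big[setU/set0]_(i <- s) W i) h x =
  \sum_(i <- s) \int[mu]_(x in W i) h x.
Proof.
move=> us mW W0; elim: s us => [|i s IH]; first by rewrite !big_nil Rintegral_set0.
rewrite /= !big_cons => /andP[nis us] ih.
have mS : measurable (\big[setU/set0]_(j <- s) W j).
  exact: bigsetU_measurable.
rewrite Rintegral_setU_null//.
  rewrite IH//; apply: integrableS ih => //; exact: measurableU.
apply: null_setI_bigsetU => // j js; apply: W0.
by apply: contraNneq nis => ->.
Qed.

End almost_disjoint.

(** * Concentration of the posterior *)

Section concentration.
Context (R : realType) (P d0 beta : R).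
Hypotheses (P0 : 0 < P) (d00 : 0 < d0) (beta2 : 2 < beta).
Context (N : nat) (x : 'I_N -> R * R) (C : set (R * R)).
Hypothesis C0 : 0 < fine (area C).
Local Notation line := (measurableTypeR R).
Local Notation f := (fun l => mean_log_power P d0 beta (x l)).
Local Notation Theta := (Theta P d0 beta x C).
Local Notation misfit := (misfit P d0 beta x).

(** This bound and [misfit_upper] compare the observed misfit with the noiseless
    one, up to an error that does not depend on the position [y]. The factors
    [1 / 2] and [2] are harmless, because the gap between the noiseless misfits
    to be separated can be taken as large as needed. *)
Lemma misfit_lower z mu M y :
  misfit mu M y / 2 - \sum_(l in M) (z l - mu l) ^+ 2 <= misfit z M y.
Proof.
rewrite mulr_suml -sumrB; apply: ler_sum => l _.
have := sqr_ge0 ((mu l - f l y) - 2 * (mu l - z l)).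
set a := f l y; rewrite !expr2; lra.
Qed.

Lemma misfit_upper z mu M y :
  misfit z M y <= 2 * misfit mu M y + 2 * \sum_(l in M) (z l - mu l) ^+ 2.
Proof.
rewrite !mulr_sumr -big_split; apply: ler_sum => l _ /=.
have := sqr_ge0 ((mu l - f l y) - (z l - mu l)).
set a := f l y; rewrite !expr2; lra.
Qed.

Lemma continuous_misfit z M : continuous (misfit z M).
Proof.
move=> y; rewrite /continuous_at.
apply: cvg_big => [|l _]; first exact: add_continuous.
have c1 : {for y, continuous (fun y => z l - f l y)}.
  by apply: cvgB; [exact: cvg_cst|exact: continuous_mean_log_power].
apply: (@continuous_comp _ _ _ (fun y => z l - f l y) (fun a : R => a ^+ 2)) => //.
exact: exprn_continuous.
Qed.

(** Trilateration: a position that explains the noiseless measurements of three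
    non-collinear sensors exactly is the source. *)
Lemma misfit_gt0 M s y : three_noncollinear x M -> y != s ->
  0 < misfit (fun l => f l s) M y.
Proof.
move=> [i [j [l [[iM jM lM] ncol]]]] ys.
rewrite lt0r misfit_ge0 andbT; apply/negP.
rewrite psumr_eq0 => [/allP all0|k _]; last exact: sqr_ge0.
have eqd k : k \in M -> eucl_dist (x k) y = eucl_dist (x k) s.
  move=> kM; apply: (mean_log_power_inj P0 d00 beta2).
  have := all0 k (mem_index_enum _); rewrite kM /= sqrf_eq0 subr_eq0.
  by move/eqP => ->.
apply: ncol; have [a [b [c [ab H]]]] := equidistant_collinear ys.
by exists a, b, c; split => // p [[->|->]|->]; apply: H; exact: eqd.
Qed.

(** Let [a] be the minimum over [K] of the noiseless misfit, and let [V] be the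
    part of the interior of [W] where it is below [a / 16]. Once the
    measurements are precise enough, the observed misfit is at least
    [7 a / 16] on [K] and at most [a / 4] on [V]. The weight of [W] is
    then at least that of [K] times [area V / area K] times an exponential that
    grows with [k]. *)
Lemma region_dominates (sigma r : R) (s : R * R) (M : {set 'I_N})
    (K W : set (R * R)) (z : nat -> 'I_N -> R) :
  0 < sigma -> 0 <= r -> three_noncollinear x M ->
  compact K -> K !=set0 -> ~ K s -> compact_region W -> W s ->
  (forall l, l \in M -> z k l @[k --> \oo] --> f l s) ->
  \forall k \near \oo,
    r * Theta (sigma ^+ 2 / k%:R) (z k) M K <
    Theta (sigma ^+ 2 / k%:R) (z k) M W.
Proof.
move=> sigma0 r0 ncol cK K0 Ks [cW regW] Ws zcvg.
have ineqK (b t e : R) : e < b / 16 -> b <= t -> 7 * b / 16 <= t / 2 - e by lra.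
have ineqV (b t e : R) : e < b / 16 -> t < b / 16 -> 2 * t + 2 * e <= b / 4.
  by lra.
have gapE (b w : R) :
  - (b / 4 / w) = - (7 * b / 16 / w) + 3 * b / 16 / w by lra.
pose mu l := f l s.
have cq : continuous (misfit mu M) by exact: continuous_misfit.
have [c Kc cmin] : exists2 c, c \in K & forall t, t \in K ->
    misfit mu M c <= misfit mu M t.
  by apply: compact_EVT_min => //; exact: continuous_subspaceT.
pose a := misfit mu M c.
have a0 : 0 < a.
  apply: misfit_gt0 => //; apply: contraPneq Ks => <-.
  by apply; exact: set_mem.
pose V := W^° `&` [set y | misfit mu M y < a / 16].
have oL : open [set y | misfit mu M y < a / 16].
  apply: (@open_comp _ _ (misfit mu M) [set b | b < a / 16]) => [y _|].
    exact: cq.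
  exact: open_lt.
have oV : open V by apply: openI => //; exact: open_interior.
have qs0 : misfit mu M s = 0.
  by rewrite /misfit big1// => l _; rewrite subrr expr0n.
have V0 : V !=set0.
  have : closure W^° s by rewrite regW.
  move=> /(_ [set y | misfit mu M y < a / 16]) [].
    by apply: open_nbhs_nbhs; split => //=; rewrite qs0 divr_gt0.
  by move=> y; exists y.
have mV := open_measurable_plane oV.
have VW : V `<=` W by move=> y [/interior_subset].
have mK := compact_measurable_plane cK.
have mW := compact_measurable_plane cW.
have Kfin := area_compact_fin cK.
have Wfin := area_compact_fin cW.
have Vfin : (area V < +oo)%E.
  by apply: le_lt_trans Wfin; apply: le_measure; rewrite ?inE.
have areaV : 0 < fine (area V).
  by rewrite fine_gt0// Vfin area_open_gt0.
pose eps k := \sum_(l in M) (z k l - mu l) ^+ 2.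
have eps0 : eps k @[k --> \oo] --> (0 : R).
  have -> : 0 = \sum_(l in M) (mu l - mu l) ^+ 2 :> R.
    by rewrite big1// => l _; rewrite subrr expr0n.
  apply: cvg_big => [|l lM]; first exact: add_continuous.
  apply: (@cvg_comp _ _ _ (fun k => z k l - mu l) (fun b : R => b ^+ 2)); last first.
    exact: exprn_continuous.
  by apply: cvgB; [exact: zcvg|exact: cvg_cst].
near=> k.
have k0 : (0 < k)%N by near: k; exists 1%N.
have kR : 0 < k%:R :> R by rewrite ltr0n.
have epsk : eps k < a / 16.
  apply: le_lt_trans (ler_norm _) _; near: k.
  by move/cvgr0Pnorm_lt : eps0; apply; rewrite divr_gt0.
set v := sigma ^+ 2 / k%:R.
have v0 : 0 < v by rewrite divr_gt0// exprn_gt0.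
have lowK y : K y -> 7 * a / 16 <= misfit (z k) M y.
  move=> Ky; apply: le_trans (misfit_lower (z k) mu M y).
  by apply: ineqK epsk _; apply: cmin; rewrite inE.
have upV y : V y -> misfit (z k) M y <= a / 4.
  move=> [_ /= qy]; apply: le_trans (misfit_upper (z k) mu M y) _.
  exact: ineqV epsk qy.
apply: (le_lt_trans (ler_wpM2l r0 (Theta_le d00 C0 v0 mK Kfin lowK))).
apply: lt_le_trans (Theta_ge d00 C0 v0 mW Wfin mV VW upV).
rewrite mulrCA ltr_pM2l ?invr_gt0//.
set g := _ ^+ #|M|.
have g0 : 0 < g.
  rewrite exprn_gt0// invr_gt0 sqrtr_gt0 mulr_gt0//.
  by rewrite mulr_gt0// pi_gt0.
have -> : r * (g * expR (- (7 * a / 16 / (2 * v))) * fine (area K)) =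
    g * (r * fine (area K) * expR (- (7 * a / 16 / (2 * v)))) by ring.
rewrite -[ltRHS]mulrA ltr_pM2l//.
pose gap := 3 * a / 16 / (2 * v).
have -> : expR (- (a / 4 / (2 * v))) =
    expR (- (7 * a / 16 / (2 * v))) * expR gap.
  by rewrite -expRD; congr expR; exact: gapE.
rewrite [ltLHS]mulrC -[ltRHS]mulrA ltr_pM2l ?expR_gt0// -ltr_pdivrMr//.
apply: (@lt_le_trans _ _ (1 + gap)); last exact: expR_ge1Dx.
rewrite -ltrBlDl.
have -> : gap = k%:R * (3 * a / 32 / sigma ^+ 2).
  by rewrite /gap /v; field; rewrite !gt_eqF.
rewrite -ltr_pdivrMr; last by rewrite divr_gt0 ?exprn_gt0 ?divr_gt0 ?mulr_gt0.
by near: k; exact: nbhs_infty_gtr.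
Unshelve. all: by end_near. Qed.

End concentration.

(** * Posterior weights and decisions *)

Section partition.
Context (R : realType) (P d0 beta : R).
Hypothesis d00 : 0 < d0.
Context (N : nat) (x : 'I_N -> R * R) (C : set (R * R)) (W : 'I_N -> set (R * R)).
Hypotheses (cC : compact C) (W_region : forall j, compact_region (W j))
  (W_cover : \bigcup_j W j = C)
  (W_disjoint : forall i j, i != j -> area (W i `&` W j) = 0%E).
Local Notation Theta := (Theta P d0 beta x C).

Lemma area_gt0 (s : R * R) (j : 'I_N) : W j s -> 0 < fine (area C).
Proof.
move=> Wjs; have [cW regW] := W_region j.
rewrite fine_gt0// (area_compact_fin cC) andbT.
apply: (@lt_le_trans _ _ (area ((W j)^°))).
  apply: area_open_gt0; first exact: open_interior.
  have : closure (W j)^° s by rewrite regW.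
  by move=> /(_ setT filterT) [y [Wy _]]; exists y.
apply: le_measure; rewrite ?inE.
- by apply: open_measurable_plane; exact: open_interior.
- exact: compact_measurable_plane.
- by move=> y /interior_subset Wy; rewrite -W_cover; exists j.
Qed.

Lemma Theta_partition (v : R) (z : 'I_N -> R) (M : {set 'I_N}) : 0 < v ->
  Theta v z M C = \sum_j Theta v z M (W j).
Proof.
move=> v0; rewrite /Theta -mulr_sumr; congr (_ * _).
have mW j := compact_measurable_plane (W_region j).1.
have CE : C = \big[setU/set0]_(j <- index_enum 'I_N) W j.
  rewrite -bigcup_seq -W_cover; apply/seteqP; split => y [j _ Wy].
    by exists j => //=; exact: mem_index_enum.
  by exists j.
rewrite [in LHS]CE Rintegral_bigsetU_null ?index_enum_uniq// -CE.
apply: integrable_likelihood => //; first exact: compact_measurable_plane.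
exact: area_compact_fin.
Qed.

(** The left-hand side is the weight of the hypothesis that the source is outside
    the regions of [M]. *)
Lemma Theta_outside (v : R) (z : 'I_N -> R) (M : {set 'I_N}) : 0 < v ->
  Theta v z M C - \sum_(j in M) Theta v z M (W j) =
  \sum_(j | j \notin M) Theta v z M (W j).
Proof.
by move=> v0; rewrite Theta_partition// (bigID (mem M))/= addrAC subrr add0r.
Qed.

End partition.

(** [t j] stands for the weight of region [j]. There are [N] regions, so the
    factor [N + 1] makes [t js] exceed the sum of all the other weights. *)
Section decision.
Context (R : realType) (N : nat) (M : {set 'I_N}) (t : 'I_N -> R) (js : 'I_N).
Hypotheses (t_ge0 : forall j, 0 <= t j) (t_js : 0 < t js).
Hypothesis t_dom : forall j, j != js -> N.+1%:R * t j < t js.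

Lemma lt_dominant j : j != js -> t j < t js.
Proof.
by move=> jjs; apply: le_lt_trans (t_dom jjs); rewrite ler_peMl// ler1n.
Qed.

Lemma sum_lt_dominant : js \in M -> \sum_(j | j \notin M) t j < t js.
Proof.
move=> jsM.
have N0 : 0 < N.+1%:R :> R by [].
rewrite -(ltr_pM2l N0) mulr_sumr.
apply: (@le_lt_trans _ _ (\sum_(j < N) t js)).
  rewrite big_mkcond; apply: ler_sum => j _.
  case: ifPn => jM; last exact: ltW.
  by apply/ltW/t_dom; apply: contraNneq jM => ->.
by rewrite sumr_const card_ord -[ltLHS]mulr_natl ltr_pM2r// ltr_nat.
Qed.

Lemma dominant_le_sum : js \notin M -> t js <= \sum_(j | j \notin M) t j.
Proof. by move=> jsM; rewrite (bigD1 js)//= lerDl sumr_ge0. Qed.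

End decision.

Lemma cvg_log_received (R : realType) (P d0 beta : R) (N : nat)
    (x : 'I_N -> R * R) (T : Type) (s : R * R) (n : 'I_N -> nat -> T -> R)
    (w : T) (i : 'I_N) :
  (\sum_(l < k) n i l w) / k%:R @[k --> \oo] --> (0 : R) ->
  log_received P d0 beta x s n k w i @[k --> \oo] -->
    mean_log_power P d0 beta (x i) s.
Proof.
move=> n0; rewrite -[X in _ --> X]addr0.
apply: cvg_trans (cvgD (cvg_cst _) n0).
apply: near_eq_cvg; near=> k.
have k0 : k%:R != 0 :> R.
  by rewrite pnatr_eq0 -lt0n; near: k; exists 1%N.
rewrite /log_received big_split/= sumr_const card_ord mulrDl -[X in _ = X / _ + _]mulr_natl.
by rewrite mulrAC divff// mul1r.
Unshelve. all: by end_near. Qed.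

Unset Implicit Arguments.

Theorem mainTheorem9 (R : realType)
  (C : set (R * R)) (N : nat) (W : 'I_N -> set (R * R)) (x : 'I_N -> R * R)
  (C_region : compact_region C) (C_connected : connected C)
  (W_region : forall j, compact_region (W j))
  (W_cover : \bigcup_j W j = C)
  (W_disjoint : forall i j, i != j -> area (W i `&` W j) = 0%E)
  (x_in_W : forall i, W i (x i))
  (e : rel 'I_N) (e_sym : symmetric e) (e_irr : irreflexive e)
  (P d0 beta sigma : R)
  (P_gt0 : 0 < P) (d0_gt0 : 0 < d0) (beta_gt2 : 2 < beta) (sigma_gt0 : 0 < sigma)
  (d : measure_display) (T : measurableType d) (Pr : probability T R)
  (n : 'I_N -> nat -> {RV Pr >-> R})
  (n_indep : mutually_independent (fun il : 'I_N * nat => n il.1 il.2))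
  (n_gauss : forall i l (B : set R), measurable B ->
     distribution Pr (n i l) B = normal_prob 0 sigma B)
  (s : R * R) (s_in_C : C s)
  (js : 'I_N) (s_in_W : forall j, W j s <-> j = js) :
  let z (k : nat) (w : T) : 'I_N -> R := log_received P d0 beta x s n k w in
  let v (k : nat) : R := sigma ^+ 2 / k%:R in
  ((forall i j, i != j -> e i j) ->
   three_noncollinear x [set: 'I_N] ->
   forall D : nat -> T -> 'I_N,
     (forall k w, (0 < k)%N ->
        argmax setT (theta_all P d0 beta x C W (v k) (z k w)) (D k w)) ->
     as_eventually_correct Pr D js)
  /\
  ((forall i, three_noncollinear x (neighborhood e i)) ->
   forall (i : 'I_N) (D : nat -> T -> option 'I_N),
     (forall k w, (0 < k)%N ->
        argmax (limited_hypotheses (neighborhood e i))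
          (theta_limited P d0 beta x C W (v k) (z k w) (neighborhood e i))
          (D k w)) ->
     as_eventually_correct Pr D
       (if js \in neighborhood e i then Some js else None)).
Proof.
move=> z v.
have C0 := area_gt0 C_region.1 W_region W_cover ((s_in_W js).2 erefl).
have avg0 : {ae Pr, forall w, forall i,
    (\sum_(l < k) n i l w) / k%:R @[k --> \oo] --> (0 : R)}.
  apply: filter_forall => i.
  apply: (@ae_average_gaussian_cvg0 _ _ _ _ _ (lt0r_neq0 sigma_gt0) (n i)).
    exact: n_gauss.
  move=> l l' A B ll' mA mB.
  apply: (independent_pair (i := (i, l)) (j := (i, l')) n_indep) => //.
  by rewrite xpair_eqE eqxx.
(* Domination of an arbitrary singleton away from [s] yields that the weight of
   the region of [s] is positive. *)
pose p : R * R := (s.1 + 1, s.2).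
have ps : p != s.
  by apply/eqP => /(congr1 fst)/= /eqP; rewrite -subr_eq0 addrAC subrr add0r oner_eq0.
have key (M : {set 'I_N}) : three_noncollinear x M ->
    {ae Pr, forall w, \forall k \near \oo, [/\ (0 < k)%N,
      0 < Theta P d0 beta x C (v k) (z k w) M (W js) &
      forall j, j != js ->
        N.+1%:R * Theta P d0 beta x C (v k) (z k w) M (W j) <
        Theta P d0 beta x C (v k) (z k w) M (W js)]}.
  move=> ncol; apply: filterS avg0 => w avgw.
  have zcvg l : l \in M -> z k w l @[k --> \oo] -->
      mean_log_power P d0 beta (x l) s.
    by move=> _; apply: cvg_log_received; exact: avgw.
  have dom r K := @region_dominates _ _ _ _ P_gt0 d0_gt0 beta_gt2 _ x _ C0
    sigma r s M K (W js) (fun k => z k w) sigma_gt0.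
  have Wjs : W js s by apply/s_in_W.
  have pos : \forall k \near \oo,
      0 < Theta P d0 beta x C (v k) (z k w) M (W js).
    have p0 : [set p] !=set0 by exists p.
    have ps' : ~ [set p] s by move=> /= sp; move: ps; rewrite -sp eqxx.
    have := dom 0 [set p] (lexx 0) ncol (@compact_set1 _ p) p0 ps' (W_region js)
      Wjs zcvg.
    by apply: filterS => k; rewrite mul0r.
  have domj : \forall k \near \oo, forall j, j != js ->
      N.+1%:R * Theta P d0 beta x C (v k) (z k w) M (W j) <
      Theta P d0 beta x C (v k) (z k w) M (W js).
    apply: filter_forall => j; have [->|jjs] := eqVneq j js.
      by near=> k.
    have H := dom N.+1%:R (W j) (ler0n _ _) ncol (W_region j).1.
    have Wj0 : W j !=set0 by exists (x j).
    have Wjs' : ~ W j s by move=> /s_in_W jE; rewrite jE eqxx in jjs.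
    by apply: filterS (H Wj0 Wjs' (W_region js) Wjs zcvg) => k Hk _.
  by near=> k; split; near: k.
(* With all-to-all communication, a decision [D k w] other than [js] would have
   a weight below that of [js]. *)
split=> [_ ncol D Dmax|ncol i D Dmax].
  apply: filterS (key _ ncol) => w; apply: filterS => k [k0 pos dom].
  have [_ Dk] := Dmax k w k0.
  apply/eqP/negPn/negP => Djs.
  have := Dk js I; rewrite leNgt => /negP; apply.
  apply: (lt_dominant _ dom) => // j; exact: Theta_ge0.
set M := neighborhood e i in Dmax *.
apply: filterS (key M (ncol i)) => w; apply: filterS => k [k0 pos dom].
have [DM Dk] := Dmax k w k0.
have vk0 : 0 < v k by rewrite divr_gt0 ?exprn_gt0 ?ltr0n.
pose t j := Theta P d0 beta x C (v k) (z k w) M (W j).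
have t0 j : 0 <= t j by exact: Theta_ge0.
have outE : theta_limited P d0 beta x C W (v k) (z k w) M None =
    \sum_(j | j \notin M) t j.
  exact: (Theta_outside P beta d0_gt0 x C_region.1 W_region W_cover
    W_disjoint (z k w) M vk0).
(* With limited communication, [js] competes directly if it is in [M], and
   otherwise its weight is part of that of [None]. *)
case: ifPn => jsM.
  have := Dk (Some js) jsM; case: (D k w) DM => [j jM|_].
    have [->//|jjs] := eqVneq j js.
    by rewrite /= leNgt (lt_dominant t0 dom).
  by rewrite outE leNgt (sum_lt_dominant pos dom jsM).
have := Dk None isT; rewrite outE; case: (D k w) DM => [j jM|//].
have jjs : j != js by apply: contraNneq jsM => <-.
move=> H; have := lt_dominant t0 dom jjs.
by rewrite ltNge (le_trans (dominant_le_sum t0 jsM) H).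
Unshelve. all: by end_near. Qed.
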